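(* Let $f:\mathbb{R}\to\mathbb{R}$, $x:\mathbb{R}$ and $n\in\mathbb{N}$. Then for all $d_1,\dots,d_n:D$, \[ f\big(x+\mathrm{Sym}_{n,1}(d_1,\dots,d_n)\big)=\sum_{i=0}^{n} f^{(i)}(x)\,\mathrm{Sym}_{n,i}(d_1,\dots,d_n). \]
   Context: Homotopy type theory setting. $\mathbb{R}$ is a set with a commutative unitary ring structure (a $\mathbb{Q}$-algebra), $D:=\{d:\mathbb{R}\mid d^2=0\}$, and the axiom holds that for every $g:D\to\mathbb{R}$ there is a unique $a:\mathbb{R}$ with $g(d)=g(0)+ad$ for all $d:D$. Consequently for each $f:\mathbb{R}\to\mathbb{R}$ there is a unique $f':\mathbb{R}\to\mathbb{R}$ with $f(x+d)=f(x)+f'(x)d$ for all $x:\mathbb{R}$, $d:D$; $f^{(0)}:=f$, $f^{(i+1)}:=(f^{(i)})'$. The functions $\mathrm{Sym}_{n,m}:D^n\to\mathbb{R}$ are defined by $\mathrm{Sym}_{0,0}:=1$, $\mathrm{Sym}_{0,m+1}:=0$, $\mathrm{Sym}_{n+1,0}:=1$, and $\mathrm{Sym}_{n+1,m+1}(d_1,\dots,d_{n+1}):=\mathrm{Sym}_{n,m+1}(d_1,\dots,d_n)+d_{n+1}\mathrm{Sym}_{n,m}(d_1,\dots,d_n)$. *)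

(* Defs.v *)
(* the number line R of synthetic differential
   geometry must NOT have decidable equality (every MathComp ring is an eqType,
   which together with the Kock-Lawvere axiom would collapse R), so we use a
   bare commutative-ring record over an arbitrary Type. *)
From Stdlib Require Import Arith.
Set Implicit Arguments.

Record QAlg := {
  car :> Type;
  rzero : car;
  rone : car;
  radd : car -> car -> car;
  rmul : car -> car -> car;
  ropp : car -> car;
  raddA : forall x y z, radd x (radd y z) = radd (radd x y) z;
  raddC : forall x y, radd x y = radd y x;
  radd0 : forall x, radd rzero x = x;
  raddN : forall x, radd (ropp x) x = rzero;
  rmulA : forall x y z, rmul x (rmul y z) = rmul (rmul x y) z;
  rmulC : forall x y, rmul x y = rmul y x;
  rmul1 : forall x, rmul rone x = x;
  rmulDl : forall x y z, rmul (radd x y) z = radd (rmul x z) (rmul y z);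
  rnat_inv : forall n : nat,
      exists y, rmul (Nat.iter (S n) (radd rone) rzero) y = rone
}.

Arguments rzero {_}. Arguments rone {_}.
Arguments radd {_} _ _. Arguments rmul {_} _ _. Arguments ropp {_} _.

Section Defs.
Variable R : QAlg.

Definition inD (d : R) : Prop := rmul d d = rzero.

Lemma inD0 : inD rzero.
Proof.
  unfold inD.
  assert (H : rmul (@rzero R) rzero = radd (rmul rzero rzero) (rmul rzero rzero)).
  { rewrite <- rmulDl, radd0. reflexivity. }
  assert (H2 := f_equal (radd (ropp (rmul (@rzero R) rzero))) H).
  rewrite raddN, raddA, raddN, radd0 in H2. symmetry; exact H2.
Qed.

Definition D0 : {d : R | inD d} := exist _ rzero inD0.

Definition KockLawvere : Prop :=
  forall g : {d : R | inD d} -> R,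
  exists a : R, (forall d : {d : R | inD d},
                   g d = radd (g D0) (rmul a (proj1_sig d)))
     /\ forall b : R, (forall d : {d : R | inD d},
                   g d = radd (g D0) (rmul b (proj1_sig d))) -> b = a.

Definition is_deriv (f g : R -> R) : Prop :=
  forall x d : R, inD d -> f (radd x d) = radd (f x) (rmul (g x) d).

(** Sym_{n,m}(d_1,...,d_n); the infinitesimal d_{k+1} is  d k. *)
Fixpoint Sym (n m : nat) (d : nat -> R) : R :=
  match n, m with
  | O, O => rone
  | O, S _ => rzero
  | S _, O => rone
  | S n', S m' => radd (Sym n' (S m') d) (rmul (d n') (Sym n' m' d))
  end.

Fixpoint sumR (F : nat -> R) (n : nat) : R :=
  match n with
  | O => F O
  | S n' => radd (sumR F n') (F (S n'))
  end.
End Defs.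
Arguments inD {R} d. Arguments is_deriv {R} f g. Arguments Sym {R} n m d.
Arguments sumR {R} F n. Arguments KockLawvere R : clear implicits.

(* Main.v *)
(* Expanding f(x + d_1 + ... + d_n) one infinitesimal at a time: since
   Sym_{n+1,1} = Sym_{n,1} + d_{n+1}, the defining property of derivatives
   gives f(y + d_{n+1}) = f(y) + f'(y) d_{n+1}, and both terms are expanded by
   induction (the second one for f' in place of f). The two sums recombine
   through the Pascal-type recursion Sym_{n+1,i+1} = Sym_{n,i+1} + d_{n+1} Sym_{n,i}. *)
Require Import Defs.
From Stdlib Require Import Ring Lia.

Section QAlgSums.
Variable R : QAlg.

Lemma QAlg_ring_theory :
  ring_theory (@rzero R) rone radd rmul (fun x y => radd x (ropp y)) ropp (@eq R).
Proof.
  constructor; try reflexivity.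
  - exact (@radd0 R).
  - exact (@raddC R).
  - exact (@raddA R).
  - exact (@rmul1 R).
  - exact (@rmulC R).
  - exact (@rmulA R).
  - exact (@rmulDl R).
  - intro x; rewrite raddC; apply raddN.
Qed.

Add Ring QAlg_ring : QAlg_ring_theory.

Lemma eq_sumR (F G : nat -> R) n : (forall i, F i = G i) -> sumR F n = sumR G n.
Proof. intro FG; induction n; simpl; rewrite ?IHn, FG; reflexivity. Qed.

Lemma sumR_add (F G : nat -> R) n :
  sumR (fun i => radd (F i) (G i)) n = radd (sumR F n) (sumR G n).
Proof. induction n; simpl; [reflexivity|]. rewrite IHn; ring. Qed.

Lemma sumR_mull (c : R) (F : nat -> R) n :
  sumR (fun i => rmul c (F i)) n = rmul c (sumR F n).
Proof. induction n; simpl; [reflexivity|]. rewrite IHn; ring. Qed.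

Lemma sumR_recl (F : nat -> R) n :
  sumR F (S n) = radd (F O) (sumR (fun i => F (S i)) n).
Proof. induction n; simpl in *; [reflexivity|]. rewrite IHn; ring. Qed.

Lemma Sym_n0 n (d : nat -> R) : Sym n 0 d = rone.
Proof. destruct n; reflexivity. Qed.

Lemma Sym_gt n m (d : nat -> R) : n < m -> Sym n m d = rzero.
Proof.
  revert m; induction n; intros [|m] lt_nm; try (exfalso; lia); simpl; try reflexivity.
  rewrite !IHn by lia; ring.
Qed.

Lemma Sym_S1 n (d : nat -> R) : Sym (S n) 1 d = radd (Sym n 1 d) (d n).
Proof. simpl; rewrite Sym_n0; ring. Qed.

Lemma sumR_Sym_S (a : nat -> R) n (d : nat -> R) :
  radd (sumR (fun i => rmul (a i) (Sym n i d)) n)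
       (rmul (sumR (fun i => rmul (a (S i)) (Sym n i d)) n) (d n))
  = sumR (fun i => rmul (a i) (Sym (S n) i d)) (S n).
Proof.
  assert (extend : sumR (fun i => rmul (a i) (Sym n i d)) n
              = sumR (fun i => rmul (a i) (Sym n i d)) (S n)).
  { simpl; rewrite (Sym_gt n (S n)) by lia; ring. }
  rewrite extend, !sumR_recl, !Sym_n0.
  rewrite (eq_sumR (fun i => rmul (a (S i)) (Sym (S n) (S i) d))
             (fun i => radd (rmul (a (S i)) (Sym n (S i) d))
                            (rmul (d n) (rmul (a (S i)) (Sym n i d)))))
    by (intro i; simpl; ring).
  rewrite sumR_add, sumR_mull; ring.
Qed.

Lemma taylor_Sym (x : R) n (d : nat -> R) :
  (forall k, k < n -> inD (d k)) ->
  forall fd : nat -> R -> R, (forall i, is_deriv (fd i) (fd (S i))) ->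
  fd O (radd x (Sym n 1 d)) = sumR (fun i => rmul (fd i x) (Sym n i d)) n.
Proof.
  induction n as [|n IHn]; intros hd fd fdS.
  - simpl; replace (radd x rzero) with x by ring; ring.
  - assert (hd_n : forall k, k < n -> inD (d k)) by (intros; apply hd; lia).
    replace (radd x (Sym (S n) 1 d)) with (radd (radd x (Sym n 1 d)) (d n))
      by (rewrite Sym_S1; ring).
    rewrite (fdS O) by (apply hd; lia).
    rewrite (IHn hd_n fd fdS), (IHn hd_n (fun i => fd (S i)) (fun i => fdS (S i))).
    exact (sumR_Sym_S (fun i => fd i x) n d).
Qed.
End QAlgSums.

(* The Kock-Lawvere axiom is what makes the derivatives fd i exist; here they
   are given. *)
Theorem theorem2p1 (R : QAlg) (KL : KockLawvere R)
  (f : R -> R) (fd : nat -> R -> R)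
  (fd0 : fd O = f) (fdS : forall i : nat, is_deriv (fd i) (fd (S i)))
  (x : R) (n : nat) (d : nat -> R) (hd : forall k : nat, k < n -> inD (d k)) :
  f (radd x (Sym n 1 d)) = sumR (fun i => rmul (fd i x) (Sym n i d)) n.
Proof.
  rewrite <- fd0; exact (taylor_Sym R x n d hd fd fdS).
Qed.
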